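(* Let $G$ be a rayless graph (possibly infinite) such that the set of induced subgraphs of $G$ is labelled well-quasi-ordered. Then $G$ has the $\aleph_0$-Erdős–Pósa property: for every graph $\Gamma$, either $\Gamma$ contains infinitely many ($\aleph_0$) pairwise disjoint subgraphs isomorphic to $G$, or there is a finite set $X\subseteq V(\Gamma)$ such that $\Gamma-X$ contains no subgraph isomorphic to $G$.
   Context: Graphs may be infinite. A graph is rayless if it contains no ray (one-way infinite path). A subgraph embedding of $H$ into $G$ is an injective map $V(H)\to V(G)$ sending edges to edges. A class $\mathcal C$ of graphs is labelled well-quasi-ordered (lwqo) if for every finite set $L$, the class of all graphs from $\mathcal C$ whose vertices are labelled by elements of $L$ is well-quasi-ordered by label-preserving subgraph embeddings. *)

(* Defs.v *)
From mathcomp Require Import all_boot.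
From mathcomp Require Import boolp classical_sets functions cardinality.

Set Implicit Arguments.
Unset Strict Implicit.
Unset Printing Implicit Defensive.

Local Open Scope classical_set_scope.

(* Simple undirected graphs on an arbitrary, possibly infinite, vertex type. *)
Record graph := Graph {
  vertex :> Type;
  adj : vertex -> vertex -> Prop;
  adj_sym : forall x y, adj x y -> adj y x;
  adj_irrefl : forall x, ~ adj x x }.

Record subgraph (G : graph) := Subgraph {
  sg_verts : set G;
  sg_adj : G -> G -> Prop;
  sg_adj_sym : forall x y, sg_adj x y -> sg_adj y x;
  sg_adj_vert : forall x y, sg_adj x y -> sg_verts x;
  sg_adj_sub : forall x y, sg_adj x y -> adj x y }.

(* {x | A x} rather than set_type A: the latter would force the universes of
   set and graph to coincide, and then set graph would be ill-typed. *)
Definition graph_of_subgraph (G : graph) (S : subgraph G) : graph :=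
  @Graph {x | sg_verts S x} (fun x y => sg_adj S (sval x) (sval y))
    (fun x y => @sg_adj_sym G S (sval x) (sval y))
    (fun x h => @adj_irrefl G (sval x) (sg_adj_sub h)).

Coercion graph_of_subgraph : subgraph >-> graph.

Definition induced (G : graph) (A : set G) : graph :=
  @Graph {x | A x} (fun x y => @adj G (sval x) (sval y))
    (fun x y => @adj_sym G (sval x) (sval y))
    (fun x => @adj_irrefl G (sval x)).

Definition induced_subgraphs (G : graph) : set graph := range (@induced G).

Definition delete (G : graph) (X : set G) : graph := induced (~` X).

Definition isomorphic (G H : graph) : Prop :=
  exists f : G -> H, bijective f /\ forall x y, adj x y <-> adj (f x) (f y).

Definition is_ray (G : graph) (r : nat -> G) : Prop :=
  injective r /\ forall n, adj (r n) (r n.+1).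

Definition rayless (G : graph) : Prop := ~ exists r : nat -> G, is_ray r.

Definition subgraph_embedding (G H : graph) (f : G -> H) : Prop :=
  injective f /\ forall x y, adj x y -> adj (f x) (f y).

Record labelled_graph (L : Type) := LabelledGraph {
  underlying :> graph;
  label : underlying -> L }.

Definition labelled_embeds (L : Type) (G H : labelled_graph L) : Prop :=
  exists f : G -> H,
    subgraph_embedding f /\ forall x, label (f x) = label x.

Definition well_quasi_ordered (T : Type) (A : set T) (R : T -> T -> Prop) :
    Prop :=
  [/\ forall x, A x -> R x x,
      forall x y z, A x -> A y -> A z -> R x y -> R y z -> R x z
    & forall s : nat -> T, (forall n, A (s n)) ->
        exists i j, (i < j)%N /\ R (s i) (s j)].

Definition lwqo (C : set graph) : Prop :=
  forall L : finType,
    well_quasi_ordered [set H : labelled_graph L | C H] (@labelled_embeds L).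

(* The copies are given as a family indexed by nat.  For nonempty G, pairwise
   disjoint members are automatically distinct; for the empty G, whose only
   copy is the empty subgraph, repetitions are allowed. *)
Definition infinitely_many_disjoint_copies (G Gamma : graph) : Prop :=
  exists S : nat -> subgraph Gamma,
    (forall n, isomorphic (S n) G) /\
    forall m n, m <> n -> sg_verts (S m) `&` sg_verts (S n) = set0.

Definition aleph0_erdos_posa (G : graph) : Prop :=
  forall Gamma : graph,
    infinitely_many_disjoint_copies G Gamma \/
    exists X : set Gamma,
      finite_set X /\ ~ exists S : subgraph (delete X), isomorphic S G.

(* Main.v *)
From mathcomp Require Import all_boot.
From mathcomp Require Import boolp classical_sets functions cardinality.
From mathcomp Require Import wochoice.
Require Import Defs.

(* Call a set of vertices C good over Y if a finite bag X can be removed from C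
   so that the rest splits into pieces, pairwise without edges between them and
   arranged in sequences c 0, c 1, ..., where c k embeds into every later c l
   compatibly with the edges to Y and X, and where all pieces are again good,
   over the union of Y and X. Labelled well-quasi-ordering arranges all but
   finitely many components in such sequences, and the remaining ones can be
   absorbed if they are good; so a bad set leads to a ray, and G is good.

   If no finite set meets all copies of G in Gamma, there are embeddings f 0,
   f 1, ... of G which are disjoint on the topmost bag. In each of the
   countably many copies to be built, every piece may be moved to any later
   member of its sequence, and the topmost bag to any f n; this leaves
   infinitely many disjoint positions for its bag. For one bag all choices
   together use only countably many vertices, and a vertex is used by countably
   many bags, whatever the cardinality of G; hence the bags can be placed
   disjointly. *)

Set Implicit Arguments.
Unset Strict Implicit.
Unset Printing Implicit Defensive.

Local Open Scope classical_set_scope.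

(** * Countable closures and well-orders *)

Lemma avoid_finite (T : Type) (A : nat -> set T) (F : set T) :
  finite_set F -> (forall m n x, A m x -> A n x -> m = n) ->
  exists m, forall x, A m x -> ~ F x.
Proof.
elim/Pchoice: T => T in A F *.
move=> /finite_seqP[s ->] disj.
suff [M HM] : exists M, forall m, (M <= m)%N -> forall x, A m x -> ~ (x \in s).
  by exists M => x Ax; exact: (HM M).
elim: s => [|y s [M HM]]; first by exists 0.
have [[k Ak]|noA] := pselect (exists k, A k y).
- exists (maxn M k.+1) => m; rewrite geq_max => /andP[Mm km] x Ax.
  rewrite inE => /orP[/eqP xy|]; last exact: HM Ax.
  by move: km; rewrite xy in Ax; rewrite (disj _ _ _ Ak Ax) ltnn.
- exists M => m Mm x Ax; rewrite inE => /orP[/eqP xy|]; last exact: HM Ax.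
  by apply: noA; exists m; rewrite -xy.
Qed.

Lemma countable_closure (T : Type) (nb : T -> set T) (a0 : T) :
  (forall a, countable (nb a)) ->
  exists C : set T,
    [/\ C a0, forall a b, C a -> nb a b -> C b & countable C].
Proof.
move=> nbc.
exists (\bigcup_n iter n (fun S => \bigcup_(a in S) nb a) [set a0]); split.
- by exists 0.
- by move=> a b [n _ na] ab; exists n.+1 => //; exists a.
- apply: bigcup_countable => // n _; elim: n => [|n IHn] /=.
    exact: countable1.
  exact: bigcup_countable.
Qed.

Lemma well_founded_total_order (T : Type) :
  exists R : T -> T -> Prop,
    [/\ well_founded R, forall x y z, R x y -> R y z -> R x z
      & forall x y, [\/ R x y, x = y | R y x]].
Proof.
have [R wo] := well_ordering_principle {classic T}.
have tot : chain R predT by apply: wo_chainW; exact: withinW.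
have anti : {in predT &, antisymmetric R}.
  by apply: wo_chain_antisymmetric; exact: withinW.
pose S (x y : T) := ~ R y x.
have StoR x y : S x y -> R x y.
  by move=> nyx; have /orP[|/nyx] := tot x y isT isT.
have wf : well_founded S.
  move=> x; apply: contrapT => nx.
  have [|z [[zn zmin] _]] := wo [pred x | `[< ~ Acc S x >]].
    by exists x; apply/asboolP.
  move: zn => /asboolP; apply; constructor => y Syz.
  by apply: contrapT => ny; apply: Syz; apply: zmin; apply/asboolP.
exists S; split=> //.
- move=> x y z xy yz zx.
  (* A failure of transitivity forces [x = z] or a 3-cycle of [S], and well-foundedness excludes the
     latter. *)
  have acyc : forall w, Acc S w -> ~ (exists u v, [/\ S u v, S v w & S w u]).
    move=> w; elim=> {}w _ IH [u [v [uv vw wu]]].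
    by apply: (IH v vw); exists w, u.
  have [xz|nxz] := pselect (R x z).
    have exz : x = z by apply: anti; rewrite ?xz ?zx.
    by subst z; apply: xy; exact: StoR.
  by apply: (acyc _ (wf x)); exists y, z.
- move=> x y; have [xy|] := pselect (R x y); last by constructor 3.
  have [yx|] := pselect (R y x); last by constructor 1.
  by constructor 2; apply: anti; rewrite ?xy ?yx.
Qed.

(** * Choosing disjoint positions along a forest *)

(** Choices are read from [a] up to its ancestor of depth 0, whose value comes last. At positive
    depth the tail of a thread is thus the thread of the parent. *)
Definition thread (N : Type) (par : N -> N) (dep : N -> nat) (sigma : N -> nat)
    (a : N) : seq nat :=
  [seq sigma b | b <- traject par a (dep a).+1].

Lemma thread_eq (N : Type) (par : N -> N) (dep : N -> nat)
    (dep_par : forall a, dep (par a) = (dep a).-1) (P : N -> Prop)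
    (s t : N -> nat) (a : N) :
  P a -> (forall b, P b -> (0 < dep b)%N -> P (par b)) ->
  (forall b, P b -> s b = t b) -> thread par dep s a = thread par dep t a.
Proof.
move=> Pa Ppar st; rewrite /thread.
have [d da] : exists d, dep a = d by eexists.
elim: d a da Pa => [|d IHd] a da Pa; first by rewrite da /= (st _ Pa).
rewrite da /= (st _ Pa); congr cons.
have dp : dep (par a) = d by rewrite dep_par da.
have := IHd _ dp (Ppar _ Pa _); rewrite dp /=; apply.
by rewrite da.
Qed.

Lemma thread_cons (N : Type) (par : N -> N) (dep : N -> nat)
    (dep_par : forall a, dep (par a) = (dep a).-1) (s : N -> nat) (a : N) :
  (0 < dep a)%N -> thread par dep s a = s a :: thread par dep s (par a).
Proof. by move=> da; rewrite /thread dep_par prednK. Qed.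

(* Only countably many nodes can conflict with a given one, so the closure of a
   node under conflicts and parents is countable. A well-order of the nodes then
   cuts them into countable layers: conflicts stay inside a layer, and parents
   never lie in a later layer. Within a layer the choices are made greedily. *)
Lemma disjoint_selection (N V : Type) (par : N -> N) (dep : N -> nat)
    (pos : N -> seq nat -> set V) :
  (forall a, dep (par a) = (dep a).-1) ->
  (forall a ls, finite_set (pos a ls)) ->
  (forall a ls F, size ls = dep a -> finite_set F ->
     exists m, forall x, pos a (m :: ls) x -> ~ F x) ->
  (forall x, countable
     [set a | exists2 ls, size ls = (dep a).+1 & pos a ls x]) ->
  exists sigma : N -> nat, forall a b x,
    pos a (thread par dep sigma a) x -> pos b (thread par dep sigma b) x ->
    a = b.
Proof.
move=> dep_par fin_pos avoid few.
pose near a x := exists2 ls, size ls = (dep a).+1 & pos a ls x.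
have near_countable a : countable (near a).
  have -> : near a =
      \bigcup_(ls in [set ls : seq nat | size ls = (dep a).+1]) pos a ls.
    by apply/seteqP; split=> x [ls]; exists ls.
  apply: bigcup_countable => [|ls _]; first exact: countableP.
  exact: finite_set_countable.
pose nb a : set N := [set par a] `|` \bigcup_(x in near a) [set b | near b x].
have nb_countable a : countable (nb a).
  rewrite /nb -bigcup2E; apply: bigcup_countable => [|[|[|i]] _] /=.
  - exact: (@countableP nat).
  - exact: countable1.
  - by apply: bigcup_countable => // x _; exact: few.
  - exact: countable0.
have [cl clP] := choice (fun a => countable_closure a nb_countable).
have [R [wfR transR totR]] := well_founded_total_order N.
(* The least node whose closure contains [a] names the layer of [a]. A layer lies within one closure
   and so is countable. *)
have least a : exists l, cl l a /\ forall l', cl l' a -> ~ R l' l.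
  have claa : cl a a by case: (clP a).
  have : exists l, cl l a by exists a.
  case=> l; elim: (wfR l) => {}l _ IH cla.
  have [[l' [l'a l'l]]|no] := pselect (exists l', cl l' a /\ R l' l).
    exact: IH l'a.
  by exists l; split=> // l' l'a l'l; apply: no; exists l'.
have {least}[lam lamP] := choice least.
(* The closure of [lam a] contains [b], so the layer of [b] is no later. Conflicts are symmetric and
   therefore force equal layers. *)
have lam_step a b : nb a b -> lam b = lam a \/ R (lam b) (lam a).
  move=> ab; have [cla _] := lamP a; have [_ minb] := lamP b.
  have clb : cl (lam a) b by case: (clP (lam a)) => _ cls _; apply: cls ab.
  by case: (totR (lam b) (lam a)) => [| |/(minb _ clb)//]; [right|left].
have lam_conf a b x : near a x -> near b x -> lam a = lam b.
  move=> ax bx.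
  have ab : nb a b by right; exists x.
  have ba : nb b a by right; exists x.
  case: (lam_step _ _ ab) => [//|r1]; case: (lam_step _ _ ba) => [//|r2].
  have := transR _ _ _ r1 r2; case: (lamP b) => /[swap] minb clb /minb.
  by move=> /(_ clb).
have /choice[j jP] : forall l, exists f : N -> nat, set_inj (cl l) f.
  by move=> l; case: (clP l) => _ _ /countable_injP.
(* [CodeSeq.code] is injective and strictly increasing under [cons]; hence it
   enumerates a layer so that parents precede their children. *)
have [n n_inj n_par] : exists2 n : N -> nat,
    forall a b, lam a = lam b -> n a = n b -> a = b &
    forall a, (0 < dep a)%N -> lam (par a) = lam a -> (n (par a) < n a)%N.
  exists (fun a => CodeSeq.code (thread par dep (j (lam a)) a)).
    move=> a b lab nab.
    have := can_inj CodeSeq.codeK nab; rewrite /thread /= -lab => -[jab _].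
    apply: (jP (lam a)) => //; rewrite inE; first by case: (lamP a).
    by rewrite lab; case: (lamP b).
  have code_cons k s : (CodeSeq.code s < CodeSeq.code (k :: s))%N.
    apply: (@leq_trans (CodeSeq.code s).*2.+1).
      by rewrite ltnS -addnn leq_addr.
    by rewrite leq_pmull // expn_gt0.
  by move=> a da lpa; rewrite (thread_cons dep_par _ da) lpa code_cons.
pose lt b a := R (lam b) (lam a) \/ (lam b = lam a /\ (n b < n a)%N).
have lt_trans a b c : lt a b -> lt b c -> lt a c.
  case=> [r1|[e1 l1]] [r2|[e2 l2]].
  - by left; apply: transR r1 r2.
  - by left; rewrite -e2.
  - by left; rewrite e1.
  - by right; rewrite e1; split=> //; apply: ltn_trans l1 l2.
have lt_par a : (0 < dep a)%N -> lt (par a) a.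
  move=> da; have [e|r] := lam_step a (par a) (or_introl erefl); last by left.
  by right; split=> //; exact: n_par.
have wf_lt : well_founded lt.
  move=> a; have [l] : exists l, l = lam a by eexists.
  elim: (wfR l) a => {}l _ IHl a ea.
  have [k] : exists k, (n a < k)%N by exists (n a).+1.
  elim: k a ea => [|k IHk] a ea; first by rewrite ltn0.
  rewrite ltnS => nak.
  constructor=> b [rba|[eba nba]]; first by apply: (IHl (lam b)); rewrite ?ea.
  by apply: IHk; [rewrite eba|exact: leq_trans nba nak].
(* Only nodes of the same layer with a smaller number have to be avoided; they are finitely many, as
   [n] is injective on a layer. *)
pose earlier a s := [set x | exists b,
  [/\ lam b = lam a, (n b < n a)%N & pos b (thread par dep s b) x]].
have earlier_fin a s : finite_set (earlier a s).
  pose f k : set N := [set b | lam b = lam a /\ n b = k].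
  apply: (@sub_finite_set _ _ (\bigcup_(k in `I_(n a))
     \bigcup_(b in f k) pos b (thread par dep s b))).
    by move=> x [b [eb nb' pb]]; exists (n b) => //; exists b.
  apply: bigcup_finite => // k _; apply: bigcup_finite => //.
  have [[b [eb nbk]]|no] := pselect (exists b, f k b).
    apply: sub_finite_set (finite_set1 b) => c [ec nck]; apply: n_inj.
      by rewrite ec.
    by rewrite nbk.
  by apply: sub_finite_set (finite_set0 _) => b h; apply: no; exists b.
pose ok a s m := forall x,
  pos a (m :: behead (thread par dep s a)) x -> ~ earlier a s x.
have [ch chP] : exists ch : N -> (N -> nat) -> nat, forall a s, ok a s (ch a s).
  have /choice[ch chP] : forall as_ : N * (N -> nat),
      exists m, ok as_.1 as_.2 m.
    move=> [a s] /=; apply: avoid; last exact: earlier_fin.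
    by rewrite size_behead size_map size_traject.
  by exists (fun a s => ch (a, s)) => a s; exact: (chP (a, s)).
(* [Fix] supplies values at earlier nodes only; [below] extends them by the default 0, and [cut] is
   the same truncation of the finished [sigma]. *)
pose below a (s : forall b, lt b a -> nat) b :=
  if pselect (lt b a) is left h then s b h else 0.
pose sigma := Fix wf_lt (fun _ => nat) (fun a s => ch a (below a s)).
pose cut a b := if pselect (lt b a) is left _ then sigma b else 0.
have sigmaE a : sigma a = ch a (cut a).
  rewrite /sigma Fix_eq; last first.
    move=> x f g fg; congr ch; apply: funext => b; rewrite /below.
    by case: pselect.
  by congr ch; apply: funext => b; rewrite /below /cut; case: pselect.
have thread_cut a b : lt b a ->
    thread par dep (cut a) b = thread par dep sigma b.
  move=> ba; apply: (thread_eq dep_par (P := fun b => lt b a)) => //.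
    by move=> c ca dc; apply: lt_trans ca; exact: lt_par.
  by move=> c ca; rewrite /cut; case: pselect.
have sigma_ok a : ok a sigma (sigma a).
  move=> x px [b [eb nb' pb]].
  have := chP a (cut a) x; rewrite -sigmaE; apply.
    move: px; congr (pos a (_ :: _) x); have [da|da] := posnP (dep a).
      by rewrite /thread da.
    rewrite !(thread_cons dep_par _ da) /= thread_cut //; exact: lt_par.
  by exists b; split=> //; rewrite thread_cut //; right.
exists sigma => a b x pa pb.
have nearP c : pos c (thread par dep sigma c) x -> near c x.
  move=> pc; exists (thread par dep sigma c) => //.
  by rewrite size_map size_traject.
have lab := lam_conf _ _ _ (nearP _ pa) (nearP _ pb).
have [nab|nba|] := ltngtP (n a) (n b); last exact: n_inj.
- by case: (sigma_ok b x pb); exists a.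
- by case: (sigma_ok a x pa); exists b.
Qed.

(** * Ascending sequences in well-quasi-orders *)

Lemma disjoint_sequence (T U : Type) (P : set T) (foot : T -> set U) :
  (forall t, finite_set (foot t)) ->
  (forall F, finite_set F -> exists2 t, P t & forall x, foot t x -> ~ F x) ->
  exists2 s : nat -> T, forall n, P (s n)
    & forall m n x, foot (s m) x -> foot (s n) x -> m = n.
Proof.
move=> fin avoid; have [t0 _ _] := avoid set0 (finite_set0 _).
have /choice[h hP] : forall F, exists t,
    finite_set F -> P t /\ forall x, foot t x -> ~ F x.
  move=> F; have [/avoid[t Pt tF]|nF] := pselect (finite_set F).
    by exists t.
  by exists t0.
pose acc := fix acc n := if n is k.+1 then acc k `|` foot (h (acc k)) else set0.
have acc_fin n : finite_set (acc n).
  by elim: n => [|n IHn] /=; [exact: finite_set0|rewrite finite_setU].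
have acc_foot m n x : (m < n)%N -> foot (h (acc m)) x -> acc n x.
  elim: n => // n IHn; rewrite ltnS leq_eqVlt => /orP[/eqP-> fx|mn fx] /=.
    by right.
  by left; exact: IHn.
exists (fun n => h (acc n)) => [n|m n x mx nx].
  by case: (hP _ (acc_fin n)).
have [mn|nm|//] := ltngtP m n.
- by case: (hP _ (acc_fin n)) => _ /(_ x nx); case; exact: acc_foot mx.
- by case: (hP _ (acc_fin m)) => _ /(_ x mx); case; exact: acc_foot nx.
Qed.

(** Infinitely many terminal indices would form a sequence without an increasing pair. Hence from
    some [M] on every index has a later partner with a larger value, and iterating this gives the
    subsequence. *)
Lemma ascending_subsequence (T : Type) (S : set T) (R : T -> T -> Prop)
    (s : nat -> T) :
  (forall x y z, S x -> S y -> S z -> R x y -> R y z -> R x z) ->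
  (forall t : nat -> T, (forall n, S (t n)) ->
     exists i j, (i < j)%N /\ R (t i) (t j)) ->
  (forall n, S (s n)) ->
  exists phi : nat -> nat,
    forall k l, (k < l)%N -> (phi k < phi l)%N /\ R (s (phi k)) (s (phi l)).
Proof.
move=> trans wqo Ss.
pose terminal i := forall j, (i < j)%N -> ~ R (s i) (s j).
have [M HM] : exists M, forall i, (M <= i)%N -> ~ terminal i.
  apply: contrapT => none.
  have /choice[h hP] : forall M, exists i, (M <= i)%N /\ terminal i.
    move=> M; apply: contrapT => no; apply: none; exists M => i Mi ti.
    by apply: no; exists i.
  pose t := fix t n := if n is k.+1 then h (t k).+1 else h 0.
  have t_term n : terminal (t n) by case: n => [|n] /=; apply: (hP _).2.
  have t_inc : {homo t : m n / (m < n)%N}.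
    apply: homo_ltn => [y x z|n] /=; first exact: ltn_trans.
    by case: (hP (t n).+1).
  have [i [j [ij Rij]]] := wqo (s \o t) (fun n => Ss (t n)).
  exact: (t_term i _ (t_inc _ _ ij)).
have /choice[nx nxP] : forall i, exists j,
    (M <= i)%N -> (i < j)%N /\ R (s i) (s j).
  move=> i; have [Mi|] := leqP M i; last by exists 0.
  apply: contrapT => no; apply: (HM i Mi) => j ij Rij.
  by apply: no; exists j.
pose phi n := iter n nx M.
have phiM n : (M <= phi n)%N.
  elim: n => [|n IHn]; first exact: leqnn.
  by apply: (leq_trans IHn); case: (nxP _ IHn) => /ltnW.
exists phi => k l; elim: l => // l IHl; rewrite ltnS leq_eqVlt.
case/orP => [/eqP->|/IHl[kl Rkl]]; first exact: nxP.
have [ll Rll] := nxP _ (phiM l); split; first exact: ltn_trans kl ll.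
exact: trans Rkl Rll.
Qed.

(* A maximal disjoint family of ascending sequences leaves only finitely many
   elements uncovered, since an infinite remainder contains another one. *)
Lemma wqo_ascending_cover (T : Type) (S : set T) (R : T -> T -> Prop) :
  (forall x y z, S x -> S y -> S z -> R x y -> R y z -> R x z) ->
  (forall t : nat -> T, (forall n, S (t n)) ->
     exists i j, (i < j)%N /\ R (t i) (t j)) ->
  exists Ch : set (nat -> T),
    [/\ forall c k, Ch c -> S (c k),
        forall c k l, Ch c -> (k < l)%N -> R (c k) (c l),
        forall c c' k l, Ch c -> Ch c' -> c k = c' l -> c = c' /\ k = l
      & finite_set [set x | S x /\ forall c k, Ch c -> c k <> x]].
Proof.
move=> trans wqo.
pose P (Ch : set (nat -> T)) := [/\ forall c k, Ch c -> S (c k),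
  forall c k l, Ch c -> (k < l)%N -> R (c k) (c l)
  & forall c c' k l, Ch c -> Ch c' -> c k = c' l -> c = c' /\ k = l].
have [F FP Ftot|Ch [[ChS ChR Chdisj] Chmax]] := @Zorn_bigcup _ P.
  split=> [c k [X FX Xc]|c k l [X FX Xc]|c c' k l [X FX Xc] [Y FY Yc']].
  - by have [h _ _] := FP X FX; exact: h.
  - by have [_ h _] := FP X FX; exact: h.
  - have [XY|YX] := Ftot X Y FX FY.
      by have [_ _ h] := FP Y FY; apply: h => //; exact: XY.
    by have [_ _ h] := FP X FX; apply: h => //; exact: YX.
exists Ch; split=> //; apply: contrapT => inf.
set Q := [set x | _] in inf.
have [t|F Ffin|s sQ sdisj] := @disjoint_sequence T T Q (fun x => [set x]).
- exact: finite_set1.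
- apply: contrapT => no; apply: inf; apply: sub_finite_set Ffin => x Qx.
  by apply: contrapT => nFx; apply: no; exists x => // y ->.
have s_inj m n : s m = s n -> m = n by move=> e; exact: (sdisj _ _ (s m)).
have sS n : S (s n) by case: (sQ n).
have [phi phiP] := ascending_subsequence trans wqo sS.
have phi_inj k l : phi k = phi l -> k = l.
  by have [/phiP[+ _]|/phiP[+ _]|//] := ltngtP k l; move=> + e; rewrite e ltnn.
pose c0 k := s (phi k).
have c0new c k l : Ch c -> c k <> c0 l.
  by move=> Chc; case: (sQ (phi l)) => _; exact.
apply: (Chmax (Ch `|` [set c0])).
  split; first by move=> c; left.
  by move=> sub; apply: (c0new c0 0 0) => //; apply: sub; right.
split=> [c k [Cc|->]|c k l [Cc|->] kl|c c' k l [Cc|->] [Cc'|->] e].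
- exact: ChS.
- exact: sS.
- exact: ChR.
- by case: (phiP k l kl).
- exact: Chdisj.
- by case: (c0new c k l).
- by case: (c0new c' l k).
- by split=> //; apply/phi_inj/s_inj.
Qed.

(** * Decompositions and good sets *)

Definition touch (G : graph) (u v : G) : Prop := u = v \/ adj u v.

(** The map is total, but only its values on [D] matter. The last clause lets the vertices of [Y]
    stay put while [D] moves. *)
Definition fixing_embedding (G : graph) (Y D D' : set G) (e : G -> G) : Prop :=
  [/\ forall v, D v -> D' (e v),
      forall u v, D u -> D v -> e u = e v -> u = v,
      forall u v, D u -> D v -> adj u v -> adj (e u) (e v)
    & forall y v, Y y -> D v -> adj y v -> adj y (e v)].

Definition pieces (G : graph) (Ch : set (nat -> set G)) : set G :=
  [set v | exists c k, Ch c /\ c k v].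

Record decomposition (G : graph) (C Y X : set G) (Ch : set (nat -> set G)) :
    Prop := Decomposition {
  bag_finite : finite_set X;
  bag_pieces : C = X `|` pieces Ch;
  bag_disjoint : forall v, X v -> ~ pieces Ch v;
  pieces_apart : forall c c' k l u v, Ch c -> Ch c' -> c k u -> c' l v ->
    touch u v -> c = c' /\ k = l;
  pieces_ascend : forall c k l, Ch c -> (k <= l)%N ->
    exists e, fixing_embedding (Y `|` X) (c k) (c l) e }.

(** An inductive predicate makes the tree of iterated decompositions well-founded: its branching may
    be infinite, its branches are finite. *)
Inductive good (G : graph) (C Y : set G) : Prop :=
  Good (X : set G) (Ch : set (nat -> set G)) of decomposition C Y X Ch &
    (forall c k, Ch c -> good (c k) (Y `|` X)).

Lemma touch_sym (G : graph) (u v : G) : touch u v -> touch v u.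
Proof. by case=> [->|/adj_sym]; [left|right]. Qed.

Lemma piece_sub (G : graph) (C Y X : set G) Ch c k :
  decomposition C Y X Ch -> Ch c -> c k `<=` C.
Proof. by case=> _ -> _ _ _ Cc v cv; right; exists c, k. Qed.

(** The additional conditions concern edges between [Z] and pieces of [C], and there are none at any
    level. *)
Lemma good_weaken (G : graph) (C Y Z : set G) :
  good C Y -> (forall z v, Z z -> C v -> ~ adj z v) -> good C (Y `|` Z).
Proof.
move=> gC; elim: gC Z => {}C {}Y X Ch dec _ IH Z ZC.
apply: (@Good _ _ _ X Ch) => [|c k Cc]; last first.
  rewrite setUAC; apply: IH => // z v Zz cv.
  by apply: ZC => //; exact: (piece_sub dec Cc cv).
case: (dec) => fX CE disj apart asc; split=> // c k l Cc kl.
have [e [e1 e2 e3 e4]] := asc c k l Cc kl; exists e; split=> //.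
move=> y v [[Yy|Zy]|Xy] cv yv.
- by apply: e4 => //; left.
- by case: (ZC y v) => //; exact: (piece_sub dec Cc cv).
- by apply: e4 => //; right.
Qed.

Lemma good0 (G : graph) (Y : set G) : good set0 Y.
Proof.
apply: (@Good _ _ _ set0 set0) => //; split=> //.
by apply/seteqP; split=> v // [|[c [k []]]].
Qed.

(** Bags and families are united. For the pieces of one side, the bag of the other side is a
    harmless addition by [good_weaken], having no edges to them. *)
Lemma good_union (G : graph) (A B Y : set G) :
  good A Y -> good B Y -> (forall u v, A u -> B v -> ~ touch u v) ->
  good (A `|` B) Y.
Proof.
case=> X1 Ch1 dec1 sub1 [X2 Ch2 dec2 sub2] AB.
have sAX : X1 `<=` A by case: dec1 => _ -> *; exact: subsetUl.
have sBX : X2 `<=` B by case: dec2 => _ -> *; exact: subsetUl.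
have sA c k : Ch1 c -> c k `<=` A by exact: piece_sub dec1.
have sB c k : Ch2 c -> c k `<=` B by exact: piece_sub dec2.
have AB' u v : A u -> B v -> ~ adj u v
  by move=> Au Bv uv; apply: (AB u v) => //; right.
have BA' u v : A u -> B v -> ~ adj v u by move=> Au Bv /adj_sym; exact: AB'.
have ABn v : A v -> B v -> False by move=> Av Bv; apply: (AB v v) => //; left.
apply: (@Good _ _ _ (X1 `|` X2) (Ch1 `|` Ch2)) => [|c k [Cc|Cc]]; last 2 first.
- rewrite setUA; apply: good_weaken; first exact: sub1.
  by move=> z v /sBX Bz /(sA _ _ Cc) Av; exact: BA'.
- rewrite setUCA setUC; apply: good_weaken; first exact: sub2.
  by move=> z v /sAX Az /(sB _ _ Cc) Bv; exact: AB'.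
case: (dec1) => f1 E1 d1 p1 a1; case: (dec2) => f2 E2 d2 p2 a2; split.
- by rewrite finite_setU.
- apply/seteqP; split=> v.
    rewrite {1}E1 {1}E2 => -[[Xv|[c [k [Cc cv]]]]|[Xv|[c [k [Cc cv]]]]].
    + by left; left.
    + by right; exists c, k; split=> //; left.
    + by left; right.
    + by right; exists c, k; split=> //; right.
  case=> [[/sAX|/sBX]|[c [k [[Cc|Cc] cv]]]]; [by left|by right| |].
    by left; exact: sA cv.
  by right; exact: sB cv.
- move=> v [Xv|Xv] [c [k [[Cc|Cc] cv]]].
  + by apply: (d1 v Xv); exists c, k.
  + by apply: (ABn v); [exact: sAX|exact: sB cv].
  + by apply: (ABn v); [exact: sA cv|exact: sBX].
  + by apply: (d2 v Xv); exists c, k.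
- move=> c c' k l u v [Cc|Cc] [Cc'|Cc'] cu cv uv.
  + exact: p1 cu cv uv.
  + by case: (AB u v) => //; [exact: sA cu|exact: sB cv].
  + by case: (AB v u); [exact: sA cv|exact: sB cu|exact: touch_sym].
  + exact: p2 cu cv uv.
- move=> c k l [Cc|Cc] kl.
  + have [e [e1 e2 e3 e4]] := a1 c k l Cc kl; exists e; split=> //.
    move=> y v [Yy|[Xy|Xy]] cv yv;
      [by apply: e4 => //; left|by apply: e4 => //; right|].
    by case: (BA' v y) => //; [exact: sA cv|exact: sBX].
  + have [e [e1 e2 e3 e4]] := a2 c k l Cc kl; exists e; split=> //.
    move=> y v [Yy|[Xy|Xy]] cv yv;
      [by apply: e4 => //; left| |by apply: e4 => //; right].
    by case: (AB' y v) => //; [exact: sAX|exact: sB cv].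
Qed.

(** The vertex [x] joins the topmost bag; the pieces and the set over which they are good stay the
    same. *)
Lemma good_add_vertex (G : graph) (C Y : set G) (x : G) :
  C x -> good (C `\ x) (Y `|` [set x]) -> good C Y.
Proof.
move=> Cx [X Ch [fX CE disj apart asc] sub].
apply: (@Good _ _ _ (x |` X) Ch) => [|c k Cc]; last first.
  by rewrite setUA; exact: sub.
split=> //.
- by rewrite finite_setU; split=> //; exact: finite_set1.
- by rewrite -setUA -CE setDUK // => _ ->.
- move=> v [->|/disj//] pv.
  have : (C `\ x) x by rewrite CE; right.
  by case=> _; apply.
- by move=> c k l Cc kl; rewrite setUA; exact: asc.
Qed.

Lemma good_pieces (G : graph) (Y : set G) (Ch : set (nat -> set G)) :
  (forall c c' k l u v, Ch c -> Ch c' -> c k u -> c' l v -> touch u v ->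
     c = c' /\ k = l) ->
  (forall c k l, Ch c -> (k <= l)%N ->
     exists e, fixing_embedding Y (c k) (c l) e) ->
  (forall c k, Ch c -> good (c k) Y) -> good (pieces Ch) Y.
Proof.
move=> apart asc sub; apply: (@Good _ _ _ set0 Ch); last by rewrite setU0.
by split=> //; rewrite ?set0U ?setU0.
Qed.

(** * Connected components *)

Inductive linked (G : graph) (A : set G) (u : G) : G -> Prop :=
| linked_refl of A u : linked A u u
| linked_step v w of linked A u v & A w & adj v w : linked A u w.

Lemma linked_sub (G : graph) (A : set G) (u v : G) : linked A u v -> A v.
Proof. by case. Qed.

Lemma linked_trans (G : graph) (A : set G) (u v w : G) :
  linked A u v -> linked A v w -> linked A u w.
Proof. by move=> uv; elim=> // {}w x _ IH; exact: linked_step IH. Qed.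

Lemma linked_sym (G : graph) (A : set G) (u v : G) :
  linked A u v -> linked A v u.
Proof.
elim=> [|{}v w uv IH Aw vw]; first exact: linked_refl.
apply: linked_trans IH; apply: linked_step (adj_sym vw).
  exact: linked_refl.
exact: linked_sub uv.
Qed.

Lemma linked_eq (G : graph) (A : set G) (u v : G) :
  linked A u v -> linked A u = linked A v.
Proof.
move=> uv; apply/seteqP; split=> w; last exact: linked_trans.
by apply: linked_trans; exact: linked_sym.
Qed.

Lemma linked_self (G : graph) (A : set G) (u v : G) :
  linked A u v -> linked (linked A u) u v.
Proof.
elim=> [Au|{}v w uv IH Aw vw]; first exact/linked_refl/linked_refl.
by apply: (linked_step IH _ vw); exact: linked_step uv Aw vw.
Qed.

(** A walk from [x] to [v] is cut at its last visit to [x]. *)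
Lemma linked_first_step (G : graph) (A : set G) (x v : G) :
  linked A x v -> v = x \/ exists2 z, adj x z & linked (A `\ x) z v.
Proof.
elim=> [|{}v w _ IH Aw vw]; first by left.
have [->|wx] := pselect (w = x); [by left|right].
case: IH => [vx|[z xz zv]]; last first.
  by exists z => //; exact: (linked_step zv _ vw).
by exists w; [rewrite -vx|exact: linked_refl].
Qed.

Definition component (G : graph) (A K : set G) : Prop :=
  exists2 u, A u & K = linked A u.

Lemma component_touch (G : graph) (A K K' : set G) (u v : G) :
  component A K -> component A K' -> K u -> K' v -> touch u v -> K = K'.
Proof.
move=> [a Aa ->] [b Ab ->] au bv uv; rewrite (linked_eq au) (linked_eq bv).
case: uv => [->//|uv]; apply: linked_eq; apply: linked_step uv.
  exact/linked_refl/(linked_sub au).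
exact: linked_sub bv.
Qed.

(** * Goodness from well-quasi-ordering and raylessness *)

Lemma fixing_embedding_id (G : graph) (Y D : set G) : fixing_embedding Y D D id.
Proof. by []. Qed.

Lemma fixing_embedding_comp (G : graph) (Y A B C : set G) (e f : G -> G) :
  fixing_embedding Y A B e -> fixing_embedding Y B C f ->
  fixing_embedding Y A C (f \o e).
Proof.
move=> [e1 e2 e3 e4] [f1 f2 f3 f4]; split=> /=.
- by move=> v /e1/f1.
- by move=> u v Au Av /f2 h; apply: e2 => //; apply: h; exact: e1.
- by move=> u v Au Av uv; apply: f3; [exact: e1|exact: e1|exact: e3].
- by move=> y v Yy Av yv; apply: f4 => //; [exact: e1|exact: e4].
Qed.

(* A vertex is labelled by its adjacency to the finite set [Y]. *)
Lemma lwqo_fixing_embedding (G : graph) (Y : set G) (t : nat -> set G) :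
  lwqo (induced_subgraphs G) -> finite_set Y ->
  exists i j, (i < j)%N /\ exists e, fixing_embedding Y (t i) (t j) e.
Proof.
move=> lw /(@finite_seqP {classic G})[s YE].
pose lab (v : G) : (size s).-tuple bool :=
  map_tuple (fun y : G => `[< adj y v >]) (in_tuple s).
pose H n := @LabelledGraph ((size s).-tuple bool) (induced (t n))
  (fun v => lab (sval v)).
have [_ _ /(_ H)] := lw ((size s).-tuple bool : finType).
case=> [n|i [j [ij [f [[f_inj f_hom] f_lab]]]]]; first by exists (t n).
exists i, j; split=> //.
pose e v := if pselect (t i v) is left h then sval (f (exist _ v h)) else v.
have eE v (h : t i v) : e v = sval (f (exist _ v h)).
  rewrite /e; case: pselect => // h'.
  by rewrite (Prop_irrelevance h h').
exists e; split=> [v h|u v hu hv|u v hu hv uv|y v Yy hv yv].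
- by rewrite (eE v h); exact: (svalP (f _)).
- rewrite (eE u hu) (eE v hv) => efv.
  have /f_inj[] // : f (exist _ u hu) = f (exist _ v hv).
  by case: (f _) efv => a ha; case: (f _) => b hb /= ab; exact: eq_exist.
- by rewrite (eE u hu) (eE v hv); exact: (f_hom (exist _ u hu) (exist _ v hv)).
(* Equal labels at [v] and [e v] mean the same neighbours in [Y]. *)
- have /(congr1 val)/= := f_lab (exist _ v hv).
  rewrite -eE => /(@eq_in_map {classic G}) /(_ y); rewrite YE in Yy.
  move=> /(_ Yy) h.
  by apply/asboolP; rewrite h; exact/asboolP.
Qed.

Lemma good_components (G : graph) (A Y : set G) :
  lwqo (induced_subgraphs G) -> finite_set Y ->
  (forall K, component A K -> good K Y) -> good A Y.
Proof.
move=> lw Yfin comp.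
have [||Ch [ChS ChR Chdisj Chfin]] := @wqo_ascending_cover _ (component A)
    (fun K K' => exists e, fixing_embedding Y K K' e).
- move=> K1 K2 K3 _ _ _ [e E] [f F].
  by exists (f \o e); exact: fixing_embedding_comp E F.
- by move=> t _; exact: lwqo_fixing_embedding.
set rem := [set x | _] in Chfin.
have good_rem : good [set v | exists2 K, rem K & K v] Y.
  have /(@finite_seqP {classic (set G)})[s remE] := Chfin.
  have -> : [set v | exists2 K, rem K & K v] =
      [set v | exists K, [/\ K \in s, rem K & K v]].
    apply/seteqP; split=> v [K]; last by case=> _ *; exists K.
    by move=> rK Kv; exists K; split=> //; move: rK; rewrite remE.
  (* The remaining components are adjoined one by one; list entries that are repeated or outside
     [rem] change nothing. *)
  elim: {remE} s => [|K s IHs].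
    have -> // : [set v | exists K, [/\ K \in [::], rem K & K v]] = set0.
      by apply/seteqP; split=> v // [K []].
    exact: good0.
  have [[rK Ks]|no] := pselect (rem K /\ K \notin s); last first.
    have <- // : [set v | exists K, [/\ K \in s, rem K & K v]] =
        [set v | exists K', [/\ K' \in K :: s, rem K' & K' v]].
    apply/seteqP; split=> v [K' [K's rK' K'v]]; exists K'; split=> //.
      by rewrite inE K's orbT.
    move: K's; rewrite inE => /orP[/eqP KK'|//]; subst K'.
    by apply: contrapT => /negP Ks; apply: no.
  have -> : [set v | exists K', [/\ K' \in K :: s, rem K' & K' v]] =
      K `|` [set v | exists K, [/\ K \in s, rem K & K v]].
    apply/seteqP; split=> v.
      case=> K' [+ rK' K'v]; rewrite inE => /orP[/eqP <-|K's]; first by left.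
      by right; exists K'.
    case=> [Kv|[K' [K's rK' K'v]]]; first by exists K; rewrite inE eqxx.
    by exists K'; rewrite inE K's orbT.
  apply: good_union => //; first by apply: comp; case: rK.
  move=> u v Ku [K' [K's [cK' _] K'v]] uv; case: rK => cK _.
  by move: Ks; rewrite (component_touch cK cK' Ku K'v uv) K's.
have -> : A = pieces Ch `|` [set v | exists2 K, rem K & K v].
  apply/seteqP; split=> v.
    move=> Av; have cK : component A (linked A v) by exists v.
    have Kv : linked A v v by exact: linked_refl.
    have [[c [k [Cc ck]]]|no] := pselect (exists c k, Ch c /\ c k = linked A v).
      by left; exists c, k; rewrite ck.
    right; exists (linked A v) => //; split=> // c k Cc ck.
    by apply: no; exists c, k.
  case=> [[c [k [Cc cv]]]|[K [[u _ ->] _] /linked_sub//]].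
  by have [u _ cE] := ChS c k Cc; move: cv; rewrite cE; exact: linked_sub.
have pieces_component c k l u v c' : Ch c -> Ch c' -> c k u -> c' l v ->
    touch u v -> c k = c' l.
  by move=> Cc Cc'; exact: component_touch (ChS _ _ Cc) (ChS _ _ Cc').
apply: good_union => //.
  apply: good_pieces => [c c' k l u v Cc Cc' cu cv uv|c k l Cc|c k Cc].
  - exact: Chdisj (pieces_component _ _ _ _ _ _ Cc Cc' cu cv uv).
  - rewrite leq_eqVlt => /orP[/eqP->|]; last exact: ChR.
    by exists id; exact: fixing_embedding_id.
  - exact/comp/ChS.
move=> u v [c [k [Cc cu]]] [K [cK nK] Kv] uv.
exact: (nK c k Cc (component_touch (ChS _ _ Cc) cK cu Kv uv)).
Qed.

(* A bad set has a bad component, which stays bad when one of its vertices is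
   moved into [Y]; moving successive neighbours yields a ray. *)
Lemma rayless_good (G : graph) :
  rayless G -> lwqo (induced_subgraphs G) -> good (setT : set G) set0.
Proof.
move=> noray lw; apply: contrapT => bad; apply: noray.
(* A state [(K, Y, x)]: [K] is connected, bad over the finite set [Y], and contains [x], the vertex
   about to be moved into [Y]. *)
pose inv (s : set G * set G * G) := [/\ finite_set s.1.2, s.1.1 s.2,
  forall v, s.1.1 v -> linked s.1.1 s.2 v & ~ good s.1.1 s.1.2].
have bad_component (A Y : set G) : finite_set Y -> ~ good A Y ->
    exists2 K, component A K & ~ good K Y.
  move=> Yfin nA; apply: contrapT => no; apply: nA.
  apply: good_components => //.
  by move=> K cK; apply: contrapT => nK; apply: no; exists K.
have step s : exists s', inv s ->
    [/\ inv s', s'.1.1 `<=` s.1.1 `\ s.2 & adj s.2 s'.2].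
  case: (pselect (inv s)) => [|ns]; last by exists s.
  case: s => [[K Y] x] [/= Yfin Kx Kconn nK].
  have Yfin' : finite_set (Y `|` [set x]).
    by rewrite finite_setU; split=> //; exact: finite_set1.
  have [|K' [u [Ku ux] K'E] nK'] := bad_component (K `\ x) _ Yfin'.
    by move=> g; apply: nK; exact: good_add_vertex g.
  (* As [K] is connected, the component of [u] contains a neighbour [z] of [x]; it becomes the next
     vertex of the ray. *)
  have [//|[z xz zu]] := linked_first_step (Kconn u Ku).
  exists (K', Y `|` [set x], z) => _; split=> //=; last first.
    by rewrite K'E => v /linked_sub.
  rewrite (linked_eq (linked_sym zu)) in K'E.
  split=> //=.
    by rewrite K'E; apply/linked_refl/(linked_sub (linked_sym zu)).
  by rewrite K'E => v; exact: linked_self.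
have [K [u _ KE] nK] := bad_component setT set0 (finite_set0 _) bad.
have [next nextP] := choice step.
pose s n := iter n next (K, set0, u).
have s_inv n : inv (s n).
  elim: n => [|n IHn]; last by case: (nextP (s n) IHn).
  split=> //=; first by rewrite KE; exact: linked_refl.
  by rewrite KE => v; exact: linked_self.
have s_step n :
    (s n.+1).1.1 `<=` (s n).1.1 `\ (s n).2 /\ adj (s n).2 (s n.+1).2.
  by case: (nextP (s n) (s_inv n)).
have s_sub m n : (m <= n)%N -> (s n).1.1 `<=` (s m).1.1.
  elim: n => [|n IHn]; first by rewrite leqn0 => /eqP->.
  rewrite leq_eqVlt => /orP[/eqP->//|/IHn mn] v sv; apply: mn.
  by case: (s_step n) => /(_ _ sv)[].
have s_neq m n : (m < n)%N -> (s m).2 <> (s n).2.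
  move=> mn e; have [_ sn _ _] := s_inv n.
  by have [/(_ _ (s_sub _ _ mn _ sn))[_ +] _] := s_step m; rewrite e; apply.
exists (fun n => (s n).2); split=> [m n e|n]; last by case: (s_step n).
by have [mn|nm|//] := ltngtP m n; [case: (s_neq _ _ mn)|case: (s_neq _ _ nm)].
Qed.

(** * The decomposition tree and its paths *)

(** A witness of [good] in [Type], from which bags and pieces can be extracted as data. *)
Inductive plan (G : graph) (C Y : set G) : Type :=
  Plan (X : set G) (Ch : set (nat -> set G)) of decomposition C Y X Ch &
    (forall c k, Ch c -> plan (c k) (Y `|` X)).

Lemma good_plan (G : graph) (C Y : set G) : good C Y -> inhabited (plan C Y).
Proof.
elim=> {}C {}Y X Ch dec _ IH; constructor; apply: (Plan dec) => c k Cc.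
have /cid[//] : exists _ : plan (c k) (Y `|` X), True.
by case: (IH c k Cc) => t; exists t.
Qed.

Definition stage (G : graph) : Type := {s : set G * set G & plan s.1 s.2}.

Definition region (G : graph) (t : stage G) : set G := (projT1 t).1.

Definition above (G : graph) (t : stage G) : set G := (projT1 t).2.

Definition bag (G : graph) (t : stage G) : set G :=
  let: Plan X _ _ _ := projT2 t in X.

Definition chains (G : graph) (t : stage G) : set (nat -> set G) :=
  let: Plan _ Ch _ _ := projT2 t in Ch.

Lemma stage_decomposition (G : graph) (t : stage G) :
  decomposition (region t) (above t) (bag t) (chains t).
Proof. by case: t => s []. Qed.

Definition piece_index (G : graph) : Type := ((nat -> set G) * nat)%type.

(* The junk value [t] is returned when [e.1] is not a chain of [t]. *)
Definition substage (G : graph) (t : stage G) (e : piece_index G) : stage G :=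
  let: existT s pl := t in
  let: Plan X Ch _ sub := pl in
  if pselect (Ch e.1) is left h
  then existT (fun s => plan s.1 s.2) (e.1 e.2, s.2 `|` X) (sub e.1 e.2 h)
  else t.

Lemma region_substage (G : graph) (t : stage G) (e : piece_index G) :
  chains t e.1 -> region (substage t e) = e.1 e.2.
Proof. by case: t => s [X Ch dec sub] /= h; case: pselect. Qed.

Lemma above_substage (G : graph) (t : stage G) (e : piece_index G) :
  chains t e.1 -> above (substage t e) = above t `|` bag t.
Proof. by case: t => s [X Ch dec sub] /= h; case: pselect. Qed.

(* A path lists, deepest first, the piece chosen at each level. *)
Fixpoint place (G : graph) (t : stage G) (p : seq (piece_index G)) : stage G :=
  if p is e :: q then substage (place t q) e else t.

Fixpoint valid (G : graph) (t : stage G) (p : seq (piece_index G)) : Prop :=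
  if p is e :: q then valid t q /\ chains (place t q) e.1 else True.

Lemma region_substage_sub (G : graph) (t : stage G) (e : piece_index G) :
  chains t e.1 -> region (substage t e) `<=` region t.
Proof.
move=> te; rewrite region_substage //.
exact: piece_sub (stage_decomposition t) te.
Qed.

Lemma valid_cat (G : graph) (t : stage G) (r q : seq (piece_index G)) :
  valid t (r ++ q) -> valid t q.
Proof. by elim: r => //= e r IH [/IH]. Qed.

Lemma bag_above (G : graph) (t : stage G) e (r q : seq (piece_index G)) :
  valid t (e :: r ++ q) -> bag (place t q) `<=` above (place t (e :: r ++ q)).
Proof.
elim: r e => [|e' r IH] e [vq te] v bv.
  by rewrite /= above_substage //; right.
by rewrite [place _ _]/= above_substage //; left; exact: IH.
Qed.

Lemma place_sub (G : graph) (t : stage G) (r q : seq (piece_index G)) :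
  valid t (r ++ q) -> region (place t (r ++ q)) `<=` region (place t q).
Proof.
elim: r => [_|e r IH /= [vq te]]; first exact: subset_refl.
by apply: subset_trans (IH vq); exact: region_substage_sub.
Qed.

Lemma bag_region (G : graph) (t : stage G) : bag t `<=` region t.
Proof. by rewrite (bag_pieces (stage_decomposition t)); exact: subsetUl. Qed.

Lemma path_exists (G : graph) (t : stage G) (v : G) :
  region t v -> exists2 p, valid t p & bag (place t p) v.
Proof.
(* Induction on the plan found at the end of the path [p], which is extended one piece at a time
   towards [v]. *)
suff gen C Y (pl : plan C Y) : forall p, valid t p ->
    place t p = existT (fun s => plan s.1 s.2) (C, Y) pl -> C v ->
    exists2 q, valid t q & bag (place t q) v.
  by case: t gen => -[C Y] pl gen; exact: (gen _ _ pl [::]).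
elim: pl => {}C {}Y X Ch dec sub IH p vp pE.
rewrite {1}(bag_pieces dec) => -[Xv|[c [k [Cc cv]]]].
  by exists p => //; rewrite pE.
apply: (IH c k Cc ((c, k) :: p)) => //=; first by rewrite pE.
rewrite pE /=; case: pselect => // h.
by rewrite (Prop_irrelevance h Cc).
Qed.

(** Where two paths first part, seen from the top, [pieces_apart] forbids touching vertices. So
    every edge of [G] joins bags on a common branch. *)
Lemma path_comparable (G : graph) (t : stage G) (p q : seq (piece_index G))
    u v :
  valid t p -> valid t q -> region (place t p) u -> region (place t q) v ->
  touch u v -> (exists r, q = r ++ p) \/ (exists r, p = r ++ q).
Proof.
move=> + vq + qv uv; elim: p => [_ _|e p IH [vp te] pu].
  by left; exists q; rewrite cats0.
have [[r qE]|[r ->]] := IH vp (region_substage_sub te pu); last first.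
  by right; exists (e :: r).
case/lastP: r qE => [|r e'] qE; first by right; exists [:: e]; rewrite qE.
left; exists r; rewrite cat_rcons in qE; rewrite qE; congr (_ ++ _ :: _).
have ve' : valid t (e' :: p) by apply: (@valid_cat _ _ r); rewrite -qE.
have ev : region (place t (e' :: p)) v.
  by apply: (@place_sub _ _ r); rewrite -qE.
case: ve' => _ te'; move: pu ev; rewrite /= !region_substage // => eu e'v.
have := pieces_apart (stage_decomposition (place t p)) te te' eu e'v uv.
by case: e e' {te eu qE te' e'v} => ? ? [? ?] /= [-> ->].
Qed.

(** * Moving pieces along their sequences *)

Lemma shift_exists (G : graph) (Y A B : set G) :
  exists e, (exists e', fixing_embedding Y A B e') -> fixing_embedding Y A B e.
Proof.
have [[e E]|no] := pselect (exists e', fixing_embedding Y A B e').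
  by exists e.
by exists id.
Qed.

(** Storing the displacement rather than the target makes every [l] an admissible choice, as pieces
    are only known to embed forwards. *)
Definition shift (G : graph) (t : stage G) (e : piece_index G) (l : nat) :
    G -> G :=
  projT1 (cid (shift_exists (above t `|` bag t) (e.1 e.2) (e.1 (e.2 + l)%N))).

Lemma shiftP (G : graph) (t : stage G) (e : piece_index G) (l : nat) :
  chains t e.1 -> fixing_embedding (above t `|` bag t)
    (region (substage t e)) (e.1 (e.2 + l)%N) (shift t e l).
Proof.
move=> te; rewrite region_substage // /shift; case: (cid _) => f /=; apply.
by apply: (pieces_ascend (stage_decomposition t)) => //; exact: leq_addr.
Qed.

(* The last entry of [ls] selects one of the embeddings [f n]; each earlier
   one moves a piece that many places up its chain. *)
Fixpoint realize (G Gamma : graph) (t : stage G) (f : nat -> G -> Gamma)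
    (p : seq (piece_index G)) (ls : seq nat) : G -> Gamma :=
  match p, ls with
  | e :: q, l :: ls' => realize t f q ls' \o shift (place t q) e l
  | _, _ => f (head 0 ls)
  end.

Lemma shift_region (G : graph) (t : stage G) e q l u :
  valid t (e :: q) -> region (place t (e :: q)) u ->
  region (place t q) (shift (place t q) e l u).
Proof.
move=> [vq te] eu; have [+ _ _ _] := shiftP l te => /(_ _ eu).
exact: (piece_sub (stage_decomposition (place t q)) te).
Qed.

Lemma realize_embedding (G Gamma : graph) (t : stage G) (f : nat -> G -> Gamma)
    (p : seq (piece_index G)) (ls : seq nat) :
  (forall n, subgraph_embedding (f n)) -> valid t p ->
  (forall u v, region (place t p) u -> region (place t p) v ->
     realize t f p ls u = realize t f p ls v -> u = v) /\
  (forall u v, region (place t p) u -> region (place t p) v ->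
     adj u v -> adj (realize t f p ls u) (realize t f p ls v)).
Proof.
move=> femb; elim: p ls => [|e q IH] [|l ls] vp /=.
- by have [f_inj f_hom] := femb 0; split=> u v _ _; [exact: f_inj|exact: f_hom].
- by have [f_inj f_hom] := femb l; split=> u v _ _; [exact: f_inj|exact: f_hom].
- by have [f_inj f_hom] := femb 0; split=> u v _ _; [exact: f_inj|exact: f_hom].
case: (vp) => vq te; have [inj hom] := IH ls vq.
have [_ s_inj s_hom _] := shiftP l te.
split=> u v eu ev uv.
  by apply: s_inj => //; apply: inj uv; exact: shift_region.
by apply: hom; [exact: shift_region|exact: shift_region|exact: s_hom].
Qed.

(** Each shift along [r] keeps the edge to [w], because [w] lies in the current bag or in the set
    above. Once the path [q] is reached, both ends are moved by the same embedding. *)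
Lemma realize_adj (G Gamma : graph) (t : stage G) (f : nat -> G -> Gamma)
    (q : seq (piece_index G)) (ls : seq nat) w :
  (forall n, subgraph_embedding (f n)) -> bag (place t q) w ->
  forall r lr v, size lr = size r -> valid t (r ++ q) ->
    region (place t (r ++ q)) v -> adj w v ->
    adj (realize t f q ls w) (realize t f (r ++ q) (lr ++ ls) v).
Proof.
move=> femb bw; elim=> [|e r IH] [|l lr] v //= size_lr vp rv wv.
  have [_ hom] := realize_embedding ls femb vp.
  by apply: hom => //; exact: bag_region.
case: (vp) => vq te; apply: IH => //; [by case: size_lr|exact: shift_region|].
have [_ _ _] := shiftP l te; apply => //.
case: r vq {size_lr vp rv te} => [|e' r] vq; first by right.
by left; exact: bag_above.
Qed.

(* The position of [x] determines one piece after the other from the top. *)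
Lemma realize_path_unique (G Gamma : graph) (t : stage G)
    (f : nat -> G -> Gamma) (p q : seq (piece_index G)) (ls : seq nat) u v :
  (forall n, subgraph_embedding (f n)) -> valid t p -> valid t q ->
  size ls = (size p).+1 -> size p = size q ->
  region (place t p) u -> region (place t q) v ->
  realize t f p ls u = realize t f q ls v -> p = q.
Proof.
move=> femb; elim: p q ls u v => [|e p IH] [|e' q] [|l ls] u v //=.
move=> vp vq [size_ls] [size_pq] eu e'v uv.
have pq : p = q.
  apply: (IH q ls (shift (place t p) e l u) (shift (place t q) e' l v)) => //.
  - by case: vp.
  - by case: vq.
  - exact: shift_region.
  - exact: shift_region.
subst q; congr cons; case: (vp) (vq) => vp' te [_ te'].
have [inj _] := realize_embedding ls femb vp'.
have {}uv : shift (place t p) e l u = shift (place t p) e' l v.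
  by apply: inj uv; exact: shift_region.
have [/(_ _ eu) su _ _ _] := shiftP l te.
have [/(_ _ e'v) sv _ _ _] := shiftP l te'.
have [] := pieces_apart (stage_decomposition (place t p)) te te' su sv.
  by left.
by case: e e' {te te' eu e'v su sv uv vp vq} => c k [c' k'] /= -> /addIn->.
Qed.

(** * Building the disjoint copies *)

Lemma disjoint_copies (G Gamma : graph) (h : nat -> G -> Gamma) :
  (forall n, subgraph_embedding (h n)) ->
  (forall m n u v, h m u = h n v -> m = n) ->
  infinitely_many_disjoint_copies G Gamma.
Proof.
move=> hemb hdisj.
pose A n x y := exists u v, [/\ adj u v, h n u = x & h n v = y].
have A_sym n x y : A n x y -> A n y x.
  by case=> u [v [/adj_sym uv ux vy]]; exists v, u.
have A_vert n x y : A n x y -> range (h n) x.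
  by case=> u [v [_ ux _]]; exists u.
have A_sub n x y : A n x y -> adj x y.
  by case=> u [v [uv <- <-]]; exact: (hemb n).2.
exists (fun n =>
  @Subgraph Gamma (range (h n)) (A n) (A_sym n) (A_vert n) (A_sub n)).
split=> [n|m n mn]; last first.
  by apply/seteqP; split=> x //= [[u _ <-] [v _ /esym/hdisj]].
have [h_inj h_hom] := hemb n.
pose to (x : {x | range (h n) x}) : G := projT1 (cid2 (svalP x)).
have toK x : h n (to x) = sval x by rewrite /to; case: (cid2 _).
pose of_ (u : G) : {x | range (h n) x} := exist _ (h n u) (imageT (h n) u).
exists to; split.
  exists of_ => [x|u]; last by apply: h_inj; rewrite toK.
  by case: x => x hx; apply: eq_exist; rewrite toK.
move=> x y /=; split=> [[u [v [uv ux vy]]]|xy].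
  by rewrite -!toK in ux vy; rewrite -(h_inj _ _ ux) -(h_inj _ _ vy).
by exists (to x), (to y); rewrite !toK.
Qed.

Lemma copy_embedding (G Gamma : graph) (X : set Gamma)
    (S : subgraph (Defs.delete X)) :
  isomorphic S G ->
  exists2 f : G -> Gamma, subgraph_embedding f & forall v, ~ X (f v).
Proof.
case=> phi [[psi phiK psiK] phi_adj].
exists (fun v => sval (sval (psi v))) => [|v]; last first.
  exact: (svalP (sval (psi v))).
split=> [u v uv|u v uv].
  apply: (can_inj psiK).
  move: (psi u) (psi v) uv => [[a ha] sa] [[b hb] sb] /= ab.
  by apply: eq_exist; exact: eq_exist.
have : adj (psi u) (psi v) by apply/phi_adj; rewrite !psiK.
by move/sg_adj_sub.
Qed.

Lemma good_erdos_posa (G : graph) :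
  good (setT : set G) set0 -> aleph0_erdos_posa G.
Proof.
move=> /good_plan[pl] Gamma.
have [hit|nohit] := pselect (exists X : set Gamma,
    finite_set X /\ ~ exists S : subgraph (Defs.delete X), isomorphic S G).
  by right.
left.
pose t : stage G := existT (fun s => plan s.1 s.2) (setT, set0) pl.
have bag_fin (s : stage G) : finite_set (bag s).
  exact: bag_finite (stage_decomposition s).
have [f|F Ffin|f femb fdisj] := @disjoint_sequence (G -> Gamma) Gamma
    (@subgraph_embedding G Gamma) (fun f => f @` bag t).
- exact: finite_image.
- have [S SG] : exists S : subgraph (Defs.delete F), isomorphic S G.
    by apply: contrapT => nS; apply: nohit; exists F.
  have [f femb fF] := copy_embedding SG.
  by exists f => // _ [v _ <-]; exact: fF.
(* The node [(k, p)] stands for the bag at path [p] in the copy number [k]. Invalid paths will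
   occupy no vertices. *)
pose N := (nat * seq (piece_index G))%type.
pose par (a : N) : N := (a.1, behead a.2).
pose dep (a : N) := size a.2.
pose pos (a : N) ls : set Gamma := [set x | valid t a.2 /\
  (realize t f a.2 ls @` bag (place t a.2)) x].
have dep_par a : dep (par a) = (dep a).-1 by rewrite /dep size_behead.
have [a ls|[k p] ls F|x|sigma sigma_disj] :=
    @disjoint_selection N Gamma par dep pos dep_par.
- apply: (@sub_finite_set _ _ (realize t f a.2 ls @` bag (place t a.2))).
    by move=> x [].
  exact: finite_image.
- move=> size_ls Ffin; have [vp|nvp] := pselect (valid t p); last first.
    by exists 0 => x [].
  suff [m Hm] : exists m, forall x,
      (realize t f p (m :: ls) @` bag (place t p)) x -> ~ F x.
    by exists m => x [_ /Hm].
  (* Changing the head entry moves the deepest piece to another, disjoint member of its sequence,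
     and injectivity of the outer moves keeps the images disjoint. For the empty path it selects
     another embedding [f m]. *)
  apply: avoid_finite => // m n x; case: p vp size_ls => [|e q] vp size_ls.
    exact: fdisj.
  case=> u eu <- [v ev /esym uv]; case: (vp) => vq te.
  have [inj _] := realize_embedding ls femb vq.
  have [su sv] := (bag_region eu, bag_region ev).
  have {}uv := inj _ _ (shift_region m vp su) (shift_region n vp sv) uv.
  have [/(_ _ su) mu _ _ _] := shiftP m te.
  have [/(_ _ sv) nv _ _ _] := shiftP n te.
  have [|_ /addnI//] := pieces_apart (stage_decomposition _) te te mu nv.
  by left.
(* For a fixed copy number and list, [realize_path_unique] leaves at most one node using [x]; there
   are only countably many such pairs. *)
- pose D (i : nat * seq nat) : set N := [set a | [/\ a.1 = i.1,
    size i.2 = (dep a).+1 & pos a i.2 x]].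
  have Dc i : countable (D i).
    have [[a [a1 asz [va [u au ux]]]]|no] := pselect (exists a, D i a).
      apply: finite_set_countable; apply: sub_finite_set (finite_set1 a).
      move=> b [b1 bsz [vb [v bv vx]]] /=.
      rewrite [a]surjective_pairing [b]surjective_pairing a1 b1; congr pair.
      apply: (realize_path_unique (t := t) (ls := i.2) (u := v) (v := u) femb)
        => //.
      - by move: bsz; rewrite asz => -[].
      - exact: bag_region.
      - exact: bag_region.
      - by rewrite ux vx.
    apply: finite_set_countable; apply: sub_finite_set (finite_set0 _) => a Da.
    by apply: no; exists a.
  have /sub_countable : ([set a | exists2 ls, size ls = (dep a).+1 &
      pos a ls x] #<= \bigcup_i D i)%card.
    by apply: subset_card_le => -[k p] [ls size_ls ax]; exists (k, ls).
  by apply; apply: bigcup_countable => //; exact: countableP.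
have pathP (v : G) : exists p, valid t p /\ bag (place t p) v.
  by have [//|p vp pv] := @path_exists G t v; exists p.
have [pth {}pathP] := choice pathP.
pose th k p := thread par dep sigma (k, p).
have size_th k p : size (th k p) = (size p).+1 by rewrite size_map size_traject.
(* Bags on one branch of the same copy share their choices on the common levels, as [realize_adj]
   needs. *)
have th_cat k r q : exists2 lr, size lr = size r & th k (r ++ q) = lr ++ th k q.
  elim: r => [|e r [lr size_lr E]]; first by exists [::].
  exists (sigma (k, e :: r ++ q) :: lr); first by rewrite /= size_lr.
  by rewrite /= -E /th thread_cons.
pose h k v := realize t f (pth v) (th k (pth v)) v.
(* A vertex of [Gamma] reveals its copy and its bag, which serves both the disjointness of the
   copies and the injectivity of each. *)
have h_path m n u v : h m u = h n v -> (m, pth u) = (n, pth v).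
  move=> uv; have [[vu bu] [vv bv]] := (pathP u, pathP v).
  by apply: (sigma_disj _ _ (h m u)); split=> //; [exists u|exists v].
apply: (@disjoint_copies _ _ h) => [k|m n u v /h_path[]//].
split=> [u v uv|u v].
  have [[] pth_uv] := h_path _ _ _ _ uv.
  have [[vu bu] [_ bv]] := (pathP u, pathP v).
  have [inj _] := realize_embedding (th k (pth u)) femb vu.
  rewrite /h -pth_uv in uv; apply: inj uv; first exact: bag_region.
  by apply: bag_region; rewrite pth_uv.
(* By [path_comparable] the two bags lie on one branch; that of [u] may be taken as the upper
   one. *)
wlog [r vr] : u v / exists r, pth v = r ++ pth u.
  move=> W uv; have [[vu bu] [vv bv]] := (pathP u, pathP v).
  have tuv : touch u v by right.
  have [E|E] := path_comparable vu vv (bag_region bu) (bag_region bv) tuv.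
    exact: W uv.
  by apply: adj_sym; apply: W => //; exact: adj_sym.
move=> uv; have [[vu bu] [vv bv]] := (pathP u, pathP v).
rewrite /h vr; have [lr size_lr ->] := th_cat k r (pth u).
by apply: realize_adj; rewrite -?vr //; exact: bag_region.
Qed.

Theorem theorem1p8 (G : graph) (hray : rayless G)
    (hlwqo : lwqo (induced_subgraphs G)) :
  aleph0_erdos_posa G.
Proof. exact/good_erdos_posa/rayless_good. Qed.
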